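(* Let $X$ and $Y$ be real-valued random variables with finite expectation. If $\mathbb{E}[X] > \mathbb{E}[Y]$, then there exists a random variable $Z$ that is independent from $X$ and $Y$ and such that $$X + Z >_{1} Y + Z.$$ In particular, $X + Z' >_{1} Y + Z'$ for every $Z'$ that is independent of $X$ and $Y$ and noisier than $Z$. Additionally, if $X, Y \in \mathcal{P}_\infty$, then $Z$ can be taken to belong to $\mathcal{P}_\infty$.
   Context: For real random variables $X,Y$, write $X \geq_1 Y$ ($X$ first-order stochastically dominates $Y$) if $\mathbb{E}[\phi(X)] \geq \mathbb{E}[\phi(Y)]$ for every increasing (i.e. non-decreasing) function $\phi:\mathbb{R}\to\mathbb{R}$ for which the two expectations are well defined; equivalently, the cumulative distribution functions satisfy $F_X(t)\le F_Y(t)$ for all $t$. Write $X >_1 Y$ if $X \geq_1 Y$ and $X$ and $Y$ have distinct distributions. $\mathcal{P}_\infty$ is the set of random variables $X$ with all finite moments: $\mathbb{E}[|X|^n]<\infty$ for all $n\in\mathbb{N}$. $Z'$ is noisier than $Z$ if $Z' = Z + W$ for some random variable $W$ independent of $Z$. Stochastic dominance depends only on distributions. The underlying probability space may be enlarged, if necessary, to carry an independent random variable of a prescribed distribution. *)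

(* Defs.v *)
From HB Require Import structures.
From mathcomp Require Import all_boot all_order all_algebra.
From mathcomp Require Import all_classical all_reals all_analysis.

Set Implicit Arguments.
Unset Strict Implicit.
Unset Printing Implicit Defensive.

Import Order.TTheory GRing.Theory Num.Theory.
Import numFieldNormedType.Exports.

Local Open Scope classical_set_scope.
Local Open Scope ring_scope.

(* Sums of real random variables and pairs of random variables are random
   variables. *)
Section mfun_closure.
Context {d d1 d2} {T : measurableType d} {T1 : measurableType d1}
  {T2 : measurableType d2} {R : realType}.

Section add.
Variables f g : {mfun T >-> R}.

Let measurable_add : measurable_fun [set: T] (f \+ g).
Proof. exact: measurable_realfun.measurable_funD. Qed.

HB.instance Definition _ :=
  isMeasurableFun.Build _ _ _ _ (f \+ g) measurable_add.
End add.

Definition pairRV (f : T -> T1) (g : T -> T2) : T -> T1 * T2 :=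
  fun t => (f t, g t).

Section pair.
Variables (f : {mfun T >-> T1}) (g : {mfun T >-> T2}).

Let measurable_pair : measurable_fun [set: T] (pairRV f g).
Proof. exact: measurable_fun_pair. Qed.

HB.instance Definition _ :=
  isMeasurableFun.Build _ _ _ _ (pairRV f g) measurable_pair.
End pair.
End mfun_closure.

Section notions.
Context {d} {T : measurableType d} {R : realType} (P : probability T R).
Local Open Scope ereal_scope.

(* [(T', P')] together with [pi : T' -> T] is an enlargement of [(T, P)]; a
   random variable [X] on [T] is then identified with [X \o pi] on [T']. *)
Definition enlargement {d'} {T' : measurableType d'} (P' : probability T' R)
    (pi : {RV P' >-> T}) : Prop :=
  forall A, measurable A -> distribution P' pi A = P A.

Definition independent {d1 d2} {T1 : measurableType d1}
    {T2 : measurableType d2} (X : {RV P >-> T1}) (Y : {RV P >-> T2}) : Prop :=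
  forall A B, measurable A -> measurable B ->
    P (X @^-1` A `&` Y @^-1` B) = distribution P X A * distribution P Y B.

(* The expectation of [f] exists in the extended reals; ['E_P[f]] is then that
   value. *)
Definition expectation_well_defined (f : T -> R) : Prop :=
  'E_P[f^\+%R] < +oo \/ 'E_P[f^\-%R] < +oo.

(* A non-decreasing [phi] is automatically Borel measurable. *)
Definition dominates1 (X Y : {RV P >-> R}) : Prop :=
  forall phi : R -> R, {homo phi : x y / (x <= y)%R} ->
    expectation_well_defined (phi \o X) ->
    expectation_well_defined (phi \o Y) ->
    'E_P[phi \o Y] <= 'E_P[phi \o X].

(* Measures are total functions on [set R]: only their values on measurable
   sets are meaningful. *)
Definition same_distribution (X Y : {RV P >-> R}) : Prop :=
  forall A, measurable A -> distribution P X A = distribution P Y A.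

Definition strictly_dominates1 (X Y : {RV P >-> R}) : Prop :=
  dominates1 X Y /\ ~ same_distribution X Y.

Definition all_moments_finite (X : {RV P >-> R}) : Prop :=
  forall n : nat, 'E_P[fun t => (`|X t| ^+ n)%R] < +oo.

Definition noisier (Z' Z : {RV P >-> R}) : Prop :=
  exists2 W : {RV P >-> R}, independent W Z & forall t, Z' t = (Z t + W t)%R.

End notions.

(* Main.v *)
Require Import Defs.
From HB Require Import structures.
From mathcomp Require Import all_boot all_order all_algebra.
From mathcomp Require Import all_classical all_reals all_analysis.
From mathcomp Require Import measurable_realfun.
From mathcomp Require Import lra.

Set Implicit Arguments.
Unset Strict Implicit.
Unset Printing Implicit Defensive.

Import Order.TTheory GRing.Theory Num.Theory.
Import numFieldNormedType.Exports.

Local Open Scope classical_set_scope.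
Local Open Scope ring_scope.

(* Let a(z) = P(Y <= z < X) and b(z) = P(X <= z < Y). Then a - b = F_Y - F_X
   and, by Tonelli, \int (a - b) = E X - E Y > 0. Taking Z = -V, where V has
   density proportional to h, X + Z dominates Y + Z as soon as
   \int b(y) h(y + t) dy <= \int a(y) h(y + t) dy for all t.
   For small c > 0, the number S = \int a(z) e^(-c|z|) dz exceeds \int b. Let
   u_0(t) = e^(-c|t|), u_(k+1)(t) = S^-1 \int b(y) u_k(y + t) dy, and let h be
   the sum of the u_k. It is integrable since \int b < S; it satisfies
   \int b(y) h(y + t) dy <= S h(t) by construction, and
   S h(t) <= \int a(y) h(y + t) dy because the bound
   e^(-c|y|) u_k(t) <= u_k(y + t) passes from u_0 to every u_k, hence to h.
   For the moments, one integrates against (1 + e|z|)^n, which is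
   submultiplicative and, for small e > 0, keeps the ratio of the series of
   integrals below 1. *)

(** * Measure-theoretic preliminaries *)

Section lebesgue_integral_translation.
Context {R : realType}.
Local Notation leb := (@lebesgue_measure R).
Local Open Scope ereal_scope.

(** Values on the intervals ]b, c] determine Lebesgue measure, and a translation preserves their
    lengths. *)
Lemma lebesgue_measure_translation (a : R) (A : set R) : measurable A ->
  leb A =
  pushforward leb (fun x : measurableTypeR R => x + a : measurableTypeR R)%R A.
Proof.
move=> mA; have mf : measurable_fun setT
    (fun x : measurableTypeR R => x + a : measurableTypeR R)%R.
  exact: measurable_funD.
pose f : {mfun measurableTypeR R >-> measurableTypeR R} :=
  HB.pack (fun x : measurableTypeR R => x + a : measurableTypeR R)%R
    (isMeasurableFun.Build _ _ _ _ _ mf).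
apply: (lebesgue_measure_unique (mu := pushforward leb f)) => //.
move=> _ [[b c]] _ <-.
transitivity (leb [set` `]b - a, c - a]%R]); last first.
  congr (leb _); apply/seteqP.
  by split => x/=; rewrite !in_itv/= ltrBlDr lerBrDr.
rewrite !lebesgue_measure_itv/= !lte_fin ltrD2r.
by case: ifP => // _; rewrite -!EFinB opprB addrA subrK.
Qed.

Lemma ge0_integral_translation (f : R -> \bar R) (a : R) :
  measurable_fun setT f -> (forall x, 0 <= f x) ->
  \int[leb]_x f (x + a)%R = \int[leb]_x f x.
Proof.
move=> mf f0; have mt : measurable_fun setT
    (fun x : measurableTypeR R => x + a : measurableTypeR R)%R.
  exact: measurable_funD.
pose t : {mfun measurableTypeR R >-> measurableTypeR R} :=
  HB.pack (fun x : measurableTypeR R => x + a : measurableTypeR R)%R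
    (isMeasurableFun.Build _ _ _ _ _ mt).
rewrite [RHS](eq_measure_integral (pushforward leb t)); last first.
  by move=> A mA _; exact: lebesgue_measure_translation.
by rewrite ge0_integral_pushforward//= preimage_setT.
Qed.

End lebesgue_integral_translation.

Section density.
Context d (T : measurableType d) (R : realType).
Variable mu : {measure set T -> \bar R}.
Variable h : T -> \bar R.
Hypotheses (mh : measurable_fun setT h) (h0 : forall x, (0 <= h x)%E).
Local Open Scope ereal_scope.

(* The proofs are arguments so that the measure structure can be inferred. *)
Definition mdensity of measurable_fun setT h & (forall x, (0 <= h x)%E) :=
  fun A : set T => \int[mu]_(x in A) h x.

Local Notation eta := (mdensity mh h0).

Let mdensity0 : eta set0 = 0.
Proof. exact: integral_set0. Qed.

Let mdensity_ge0 A : 0 <= eta A.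
Proof. exact: integral_ge0. Qed.

Let mdensity_sigma_additive : semi_sigma_additive eta.
Proof.
move=> F mF tF mUF; apply: cvg_toP.
  apply: ereal_nondecreasing_is_cvgn => m n mn.
  by apply: lee_sum_nneg_natr => // k _ _; exact: integral_ge0.
by rewrite /mdensity ge0_integral_bigcup//; exact: measurable_funTS.
Qed.

HB.instance Definition _ :=
  isMeasure.Build _ _ _ eta mdensity0 mdensity_ge0 mdensity_sigma_additive.

Import HBNNSimple.

(** Monotone convergence on both sides reduces [f] to its simple approximations, and linearity
    reduces these to indicators, where the equality is the definition of [mdensity]. *)
Lemma ge0_integral_mdensity (f : T -> \bar R) :
  measurable_fun setT f -> (forall x, 0 <= f x) ->
  \int[eta]_x f x = \int[mu]_x (f x * h x).
Proof.
move=> mf f0; pose f_ := nnsfun_approx measurableT mf.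
have mfh n : measurable_fun setT (fun x => (f_ n x)%:E * h x).
  by apply: emeasurable_funM => //; exact/measurable_EFinP.
transitivity (limn (fun n => \int[eta]_x (f_ n x)%:E)).
  rewrite -monotone_convergence//.
  - apply: eq_integral => x _; apply/esym/cvg_lim => //.
    exact: cvg_nnsfun_approx.
  - by move=> n; exact/measurable_EFinP.
  - by move=> n x _; rewrite lee_fin.
  - by move=> x _ m n mn; rewrite lee_fin; exact/lefP/nd_nnsfun_approx.
transitivity (limn (fun n => \int[mu]_x ((f_ n x)%:E * h x))); last first.
  rewrite -monotone_convergence//.
  - apply: eq_integral => x _; apply: cvg_lim => //.
    have cf : (f_ n x)%:E @[n --> \oo] --> f x by exact: cvg_nnsfun_approx.
    (* Limits of products fail only for 0 times infinity, so zeros are treated apart: where [h x] is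
       0 all products vanish, and where [f x] is 0 so do its approximations, which lie between 0 and
       [f x]. *)
    have [hx0|hx0] := eqVneq (h x) 0.
      by rewrite hx0 mule0; under eq_fun do rewrite mule0; exact: cvg_cst.
    have [fx0|fx0] := eqVneq (f x) 0; last first.
      apply: cvgeM => //; last exact: cvg_cst.
      rewrite /mule_def.
      by case: (f x) (h x) fx0 hx0 (f0 x) (h0 x) => [s| |] [t| |].
    rewrite fx0 mul0e (_ : (fun _ => _) = cst 0); first exact: cvg_cst.
    apply/funext => n /=; rewrite (_ : (f_ n x)%:E = 0) ?mul0e//.
    apply/eqP; rewrite eq_le [X in _ && X]lee_fin fun_ge0 andbT -fx0.
    by rewrite nnsfun_approxE; exact: le_approx.
  - by move=> n x _; rewrite mule_ge0// lee_fin.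
  - move=> x _ m n mn; rewrite lee_wpmul2r// lee_fin.
    exact/lefP/nd_nnsfun_approx.
congr (lim (_ @ \oo)); apply/funext => n.
under [LHS]eq_integral do rewrite fimfunE -fsumEFin//.
rewrite ge0_integral_fsum//; last 2 first.
- by move=> r; exact/measurable_EFinP/measurable_funM.
- by move=> r x _; rewrite nnfun_muleindic_ge0.
under [RHS]eq_integral => x _.
  rewrite fimfunE -fsumEFin// fsbig_finite//= ge0_sume_distrl; last first.
    by move=> r _; rewrite nnfun_muleindic_ge0.
  over.
rewrite ge0_integral_sum//; last 2 first.
- move=> r; apply: emeasurable_funM => //.
  exact/measurable_EFinP/measurable_funM.
- by move=> r x _; rewrite mule_ge0// nnfun_muleindic_ge0.
rewrite fsbig_finite//=; apply: eq_big_seq => r; rewrite in_fset_set// inE/=.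
move=> [t _ <-]; set c := f_ n t.
have c0 : (0 <= c)%R by [].
under [RHS]eq_integral do rewrite EFinM -muleA.
rewrite ge0_integralZl//; last 2 first.
- by apply: emeasurable_funM => //; exact/measurable_EFinP.
- by move=> x _; rewrite mule_ge0// lee_fin.
rewrite integralZl_indic_nnsfun//; congr (_ * _).
rewrite integral_indic// setIT /mdensity.
rewrite [LHS]integral_mkcond; apply: eq_integral => x _.
by rewrite patchE indicE; case: ifP => _; rewrite ?mul1e ?mul0e.
Qed.

End density.

(** * Independence and dominance *)

Section independent_integral.
Context d d1 d2 (T : measurableType d) (T1 : measurableType d1)
  (T2 : measurableType d2) (R : realType) (P : probability T R).
Local Open Scope ereal_scope.

(** Independence says that the joint law agrees with the product of the laws on rectangles, hence
    everywhere; Tonelli then iterates the integral. *)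
Lemma ge0_integral_independent (X : {RV P >-> T1}) (Y : {RV P >-> T2})
    (f : T1 * T2 -> \bar R) :
  independent X Y -> measurable_fun setT f -> (forall z, 0 <= f z) ->
  \int[P]_t f (X t, Y t) =
  \int[distribution P X]_x \int[distribution P Y]_y f (x, y).
Proof.
move=> indXY mf f0.
rewrite -(fubini_tonelli1 _ mf f0).
rewrite (eq_measure_integral (distribution P (pairRV X Y : {RV P >-> _}))).
  by rewrite ge0_integral_distribution.
by move=> A mA _; exact: product_measure_unique.
Qed.

End independent_integral.

(** * From distribution functions to first-order dominance *)

Section cdf_dominance.
Context d (T : measurableType d) (R : realType) (P : probability T R).
Local Open Scope ereal_scope.

(** A proper nonempty down-set is a ray ending at [sup A]. If the ray is closed, a constant sequence
    serves; if it is open, the closed rays ending at [sup A - 1/(n+1)] exhaust it. Closed rays are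
    the sets whose probability a distribution function gives. *)
Lemma down_set_bigcup (A : set R) : (forall x y, (x <= y)%R -> A y -> A x) ->
  A = set0 \/ A = setT \/
  exists2 u : nat -> R, nondecreasing_seq u & A = \bigcup_n `]-oo, u n]%classic.
Proof.
move=> dA; have [->|/set0P[a Aa]] := eqVneq A set0; first by left.
have [->|/eqP AT] := eqVneq A setT; first by right; left.
right; right; have [b nAb] : exists b, ~ A b.
  by apply/existsNP => AA; apply: AT; apply/seteqP; split.
have ubA : has_ubound A.
  exists b => x Ax; rewrite leNgt; apply/negP => /ltW bx.
  exact/nAb/(dA _ _ bx).
have supA : has_sup A by split => //; exists a.
have [AsA|nAsA] := pselect (A (sup A)).
  exists (fun=> sup A) => //; apply/seteqP; split => x.
    by move=> Ax; exists 0%N => //=; rewrite in_itv/= ub_le_sup.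
  by move=> [_ _ /=]; rewrite in_itv/= => /dA; exact.
exists (fun n => sup A - n.+1%:R^-1)%R.
  move=> m n mn; rewrite lerD2l lerN2 lef_pV2 ?posrE// ler_nat.
  exact: mn.
apply/seteqP; split => x.
  move=> Ax; have xsA : (x < sup A)%R.
    rewrite lt_neqAle ub_le_sup// andbT; apply/eqP => xE.
    by apply: nAsA; rewrite -xE.
  have [n _ nx] : \forall n \near \oo, (n.+1%:R^-1 < sup A - x)%R.
    by apply: near_infty_natSinv_lt (PosNum _); rewrite subr_gt0.
  exists n => //=; rewrite in_itv/= lerBrDl -lerBrDr.
  exact/ltW/nx/leqnn.
move=> [n _ /=]; rewrite in_itv/= => xn.
have n0 : (0 < n.+1%:R^-1 :> R)%R by [].
have [y Ay ny] := sup_adherent n0 supA.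
by apply: dA Ay; exact: le_trans xn (ltW ny).
Qed.

Lemma le_cdf_down_set (U V : {RV P >-> R}) (A : set R) :
  (forall r, cdf U r <= cdf V r) -> measurable A ->
  (forall x y, (x <= y)%R -> A y -> A x) ->
  distribution P U A <= distribution P V A.
Proof.
move=> UV mA /down_set_bigcup[->|[->|[u ndu AE]]].
- by rewrite !measure0.
- by rewrite !probability_setT.
- have cvgA (W : {RV P >-> R}) :
      cdf W (u n) @[n --> \oo] --> distribution P W A.
    rewrite {1}AE; apply: nondecreasing_cvg_mu => //.
    + by rewrite -AE.
    + by move=> m n mn; apply/subsetPset; apply: subset_itvl; exact: ndu.
  have cU := cvgA U; have cV := cvgA V.
  rewrite -(cvg_lim _ cU)// -(cvg_lim _ cV)//.
  apply: lee_lim; [by apply: cvgP cU|by apply: cvgP cV|exact: nearW].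
Qed.

Lemma le_cdf_up_set (U V : {RV P >-> R}) (A : set R) :
  (forall r, cdf U r <= cdf V r) -> measurable A ->
  (forall x y, (x <= y)%R -> A x -> A y) ->
  distribution P V A <= distribution P U A.
Proof.
move=> UV mA uA; have mCA := measurableC mA.
rewrite -(setCK A).
have CE (W : {RV P >-> R}) :
    distribution P W (~` ~` A) = 1 - distribution P W (~` A).
  exact: probability_setC.
rewrite !CE; apply: leeB => //; apply: le_cdf_down_set => //.
by move=> x y xy nAy /(uA _ _ xy).
Qed.

(** Layer-cake formula: the expectation of a nonnegative variable is the integral of its tail
    probabilities. *)
Lemma le_expectation_superlevel (U V : {RV P >-> R}) (f : R -> R) :
  measurable_fun setT f -> (forall x, 0 <= f x)%R ->
  (forall r, distribution P V [set x | (r < f x)%R] <=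
             distribution P U [set x | (r < f x)%R]) ->
  'E_P[f \o V] <= 'E_P[f \o U].
Proof.
move=> mf f0 VU; pose g : {mfun R >-> R} :=
  HB.pack f (isMeasurableFun.Build _ _ _ _ _ mf).
have -> : 'E_P[f \o V] = 'E_P[(g \o V : {RV P >-> R})] by [].
have -> : 'E_P[f \o U] = 'E_P[(g \o U : {RV P >-> R})] by [].
rewrite !ge0_expectation_ccdf//; try by move=> x; exact: f0.
apply: ge0_le_integral => //; [| |move=> r _].
- by apply: measurable_funTS; exact: ccdf_measurable.
- by apply: measurable_funTS; exact: ccdf_measurable.
have ccdfE (W : {RV P >-> R}) :
    ccdf (g \o W : {RV P >-> R}) r = distribution P W [set x | (r < f x)%R].
  congr (P _); apply/seteqP.
  by split => t/=; rewrite in_itv/= andbT.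
by rewrite !ccdfE.
Qed.

(** The superlevel sets of the positive part of [phi] are up-sets and those of its negative part are
    down-sets, so the two expectations compare in opposite directions. *)
Lemma le_cdf_dominates1 (U V : {RV P >-> R}) :
  (forall r, cdf U r <= cdf V r) -> dominates1 U V.
Proof.
move=> UV phi ndphi _ _.
have mphi : measurable_fun setT phi by apply: nondecreasing_measurable.
have mpos : measurable_fun setT phi^\+%R by exact: measurable_funrpos.
have mneg : measurable_fun setT phi^\-%R by exact: measurable_funrneg.
have msup (f : R -> R) r : measurable_fun setT f ->
    measurable [set x : R | (r < f x)%R].
  move=> mf; rewrite -[X in measurable X]setTI.
  have mr : measurable_fun setT (fun x => r < f x)%R.
    exact: measurable_fun_ltr.
  exact: (mr measurableT [set true]).
have EE (W : {RV P >-> R}) :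
  'E_P[phi \o W] = 'E_P[phi^\+%R \o W] - 'E_P[phi^\-%R \o W].
  rewrite unlock integralE; congr (_ - _); apply: eq_integral => t _.
    exact: (congr1 (@^~ t) (funerpos (phi \o W))).
  exact: (congr1 (@^~ t) (funerneg (phi \o W))).
rewrite !EE; apply: leeB; apply: le_expectation_superlevel => //.
- move=> r; apply: le_cdf_up_set => //; first exact: msup.
  move=> x y /ndphi xy /= /lt_le_trans; apply.
  by rewrite /funrpos ge_max !le_max xy lexx orbT.
- move=> r; apply: le_cdf_down_set => //; first exact: msup.
  move=> x y /ndphi xy /= /lt_le_trans; apply.
  by rewrite /funrneg ge_max !le_max lerN2 xy lexx orbT.
Qed.

End cdf_dominance.

(** * The densities P(U <= z < V) *)

Section gap.
Context d (T : measurableType d) (R : realType) (P : probability T R).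
Local Notation leb := (@lebesgue_measure R).
Local Open Scope ereal_scope.

(** In the notation of the overview, [gap Y X] is a and [gap X Y] is b. *)
Definition gap (U V : {RV P >-> R}) (z : R) : \bar R :=
  P [set t | (U t <= z)%R /\ (z < V t)%R].

Implicit Types U V X Y Z : {RV P >-> R}.

Let measurable_gap_graph U V :
  measurable [set p : T * R | (U p.1 <= p.2)%R /\ (p.2 < V p.1)%R].
Proof.
have mU : measurable_fun setT (fun p : T * R => U p.1).
  by apply: (measurableT_comp (f := U)).
have mV : measurable_fun setT (fun p : T * R => V p.1).
  by apply: (measurableT_comp (f := V)).
have m1 : measurable_fun setT (fun p : T * R => U p.1 <= p.2)%R.
  exact: measurable_fun_ler.
have m2 : measurable_fun setT (fun p : T * R => p.2 < V p.1)%R.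
  exact: measurable_fun_ltr.
have := measurableI _ _
  (m1 measurableT [set true] I) (m2 measurableT [set true] I).
by rewrite !setTI.
Qed.

Lemma gap_ge0 U V z : 0 <= gap U V z.
Proof. exact: measure_ge0. Qed.

Lemma gapE U V z :
  gap U V z = P (ysection
    [set p : T * R | (U p.1 <= p.2)%R /\ (p.2 < V p.1)%R] z).
Proof.
by rewrite /gap; congr (P _); apply/seteqP; split => t; rewrite /ysection/= inE.
Qed.

Lemma measurable_gap U V : measurable_fun setT (gap U V).
Proof.
rewrite (_ : gap U V = fun z => P (ysection
  [set p : T * R | (U p.1 <= p.2)%R /\ (p.2 < V p.1)%R] z)).
  exact: measurable_fun_ysection.
by apply/funext => z; exact: gapE.
Qed.

Lemma measurable_gap_set U V z :
  measurable [set t | (U t <= z)%R /\ (z < V t)%R].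
Proof.
rewrite (_ : [set t | _] =
  (U @^-1` `]-oo, z]%classic) `&` (V @^-1` `]z, +oo[%classic)).
  by apply: measurableI; exact: measurable_funPTI.
by apply/seteqP; split => t; rewrite /= !in_itv/= andbT.
Qed.

(** Both sides are the probability that [U] or [V] is at most [z]. The additive form avoids
    subtraction in the extended reals. *)
Lemma gap_cdf U V z : gap U V z + cdf V z = gap V U z + cdf U z.
Proof.
have gapU X Y : gap X Y z + cdf Y z = P [set t | (X t <= z)%R \/ (Y t <= z)%R].
  rewrite /cdf /distribution /= /pushforward -measureU//; last 3 first.
  - exact: measurable_gap_set.
  - exact: measurable_funPTI.
  - apply/seteqP; split => // t [[_ /=]]; rewrite in_itv/= => zY.
    by rewrite leNgt zY.
  congr (P _); apply/seteqP; split => t /=; rewrite !in_itv/=.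
    by move=> [[? _]|?]; [left|right].
  move=> [Xz|Yz]; last by right.
  by have [|] := leP (Y t) z; [right|left].
rewrite !gapU; congr (P _).
by apply/seteqP; split => t /= [?|?]; by [left|right].
Qed.

(** Integrating out the sample point gives [gap U V z * w z]; integrating out [z] gives the integral
    of [w] over [U t, V t[. Tonelli equates the two. *)
Let gap_integrand U V (w : R -> \bar R) (p : T * measurableTypeR R) : \bar R :=
  (\1_[set p : T * R | (U p.1 <= p.2)%R /\ (p.2 < V p.1)%R] p)%:E * w p.2.

Let measurable_gap_integrand U V (w : R -> \bar R) :
  measurable_fun setT w -> measurable_fun setT (gap_integrand U V w).
Proof.
move=> mw; apply: emeasurable_funM; last exact: measurableT_comp.
by apply/measurable_EFinP; apply: measurable_indic; exact: measurable_gap_graph.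
Qed.

Let gap_integrand_ge0 U V (w : R -> \bar R) : (forall z, 0 <= w z) ->
  forall p, 0 <= gap_integrand U V w p.
Proof. by move=> w0 p; rewrite mule_ge0// lee_fin. Qed.

Let integral_gap_integrand U V (w : R -> \bar R) t :
  \int[leb]_z gap_integrand U V w (t, z) = \int[leb]_(z in `[U t, V t[) w z.
Proof.
rewrite [RHS]integral_mkcond; apply: eq_integral => z _.
rewrite /gap_integrand patchE indicE /=.
have [zI|zI] := boolP (z \in [set` `[U t, V t[]).
  by rewrite mem_set ?mul1e//; move: zI; rewrite inE/= in_itv/= => /andP.
rewrite memNset ?mul0e//; apply: contraNnot zI => -[Uz zV].
by rewrite inE/= in_itv/= Uz zV.
Qed.

Lemma measurable_integral_itv U V (w : R -> \bar R) :
  measurable_fun setT w -> (forall z, 0 <= w z) ->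
  measurable_fun setT (fun t => \int[leb]_(z in `[U t, V t[) w z).
Proof.
move=> mw w0; under eq_fun do rewrite -integral_gap_integrand.
apply: (measurable_fun_fubini_tonelli_F (m2 := leb)).
  exact: measurable_gap_integrand.
exact: gap_integrand_ge0.
Qed.

Lemma ge0_integral_gap U V (w : R -> \bar R) :
  measurable_fun setT w -> (forall z, 0 <= w z) ->
  \int[leb]_z (gap U V z * w z) =
  \int[P]_t \int[leb]_(z in `[U t, V t[) w z.
Proof.
move=> mw w0; transitivity (\int[leb]_z \int[P]_t gap_integrand U V w (t, z)).
  apply: eq_integral => z _; rewrite /gap_integrand/=.
  rewrite ge0_integralZr//=; last first.
    apply/measurable_EFinP; apply: measurable_indic.
    exact: measurable_gap_set.
  congr (_ * _); transitivity
    (\int[P]_t (\1_[set t | (U t <= z)%R /\ (z < V t)%R] t)%:E) => //.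
  by rewrite integral_indic// ?setIT//; exact: measurable_gap_set.
rewrite -(fubini_tonelli _ (measurable_gap_integrand U V mw)
  (gap_integrand_ge0 U V w0)).
by apply: eq_integral => t _; exact: integral_gap_integrand.
Qed.

Lemma integral_gap U V :
  \int[leb]_z gap U V z = \int[P]_t (Num.max (V t - U t) 0)%:E.
Proof.
transitivity (\int[leb]_z (gap U V z * cst 1 z)).
  by apply: eq_integral => z _; rewrite mule1.
rewrite ge0_integral_gap//; apply: eq_integral => t _.
rewrite integral_cst//= mul1e lebesgue_measure_itv/= lte_fin.
have [UV|VU] := ltP (U t) (V t).
  by rewrite max_l ?subr_ge0 ?ltW.
by rewrite max_r ?subr_le0.
Qed.

Lemma integral_gap_fin_num U V :
  (U : T -> R) \in Lfun P 1 -> (V : T -> R) \in Lfun P 1 ->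
  \int[leb]_z gap U V z \is a fin_num.
Proof.
move=> /Lfun1_integrable iU /Lfun1_integrable iV.
have /integrable_funepos : P.-integrable setT (EFin \o (V \- U)%R).
  exact: (integrableB _ iV iU).
move=> /(_ measurableT)/integrable_fin_num => /(_ measurableT).
rewrite integral_gap; congr (_ \is a fin_num); apply: eq_integral => t _.
by rewrite funerpos.
Qed.

(** By [integral_gap], the two integrals are those of the positive and negative parts of [X - Y]. *)
Lemma expectation_gap X Y :
  (X : T -> R) \in Lfun P 1 -> (Y : T -> R) \in Lfun P 1 ->
  'E_P[X] - 'E_P[Y] = \int[leb]_z gap Y X z - \int[leb]_z gap X Y z.
Proof.
move=> LX LY; rewrite -expectationB// unlock integralE !integral_gap.
congr (_ - _); apply: eq_integral => t _.
  exact: (congr1 (@^~ t) (funerpos (X \- Y)%R)).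
rewrite [LHS](congr1 (@^~ t) (funerneg (X \- Y)%R))/=.
by rewrite /funrneg/= opprB.
Qed.

(* \int (F_(Y + Z) - F_(X + Z)) = E X - E Y for every Z, integrable or not and
   whatever its dependence on X and Y, because the inner Tonelli integral is the
   pathwise difference. *)
Lemma add_same_distribution X Y Z :
  (X : T -> R) \in Lfun P 1 -> (Y : T -> R) \in Lfun P 1 ->
  same_distribution ((X \+ Z)%R : {RV P >-> R}) ((Y \+ Z)%R : {RV P >-> R}) ->
  'E_P[X] = 'E_P[Y].
Proof.
move=> LX LY XYZ.
pose U : {RV P >-> R} := (X \+ Z)%R; pose V : {RV P >-> R} := (Y \+ Z)%R.
(* Equal distribution functions cancel from [gap_cdf], their values being finite. *)
have gUV z : gap U V z = gap V U z.
  have := gap_cdf U V z; rewrite /cdf (XYZ `]-oo, z]%classic)//.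
  move=> /(congr1 (fun e => e - distribution P V `]-oo, z]%classic)).
  by rewrite !addeK ?fin_num_measure.
have : \int[leb]_z gap X Y z = \int[leb]_z gap Y X z.
  have gap_add X1 Y1 (X2 := (X1 \+ Z)%R : {RV P >-> R})
      (Y2 := (Y1 \+ Z)%R : {RV P >-> R}) :
      \int[leb]_z gap X1 Y1 z = \int[leb]_z gap X2 Y2 z.
    rewrite !integral_gap; apply: eq_integral => t _.
    by rewrite /X2 /Y2/= (addrC (X1 t)) addrKA.
  rewrite (gap_add X Y) (gap_add Y X).
  by apply: eq_integral => z _; exact: gUV.
move=> gXY; have := expectation_gap LX LY.
rewrite gXY subee ?integral_gap_fin_num// => /eqP.
by rewrite sube_eq ?expectation_fin_num// ?add0e => /eqP.
Qed.

End gap.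

(** * The smoothing density *)

Section exponential_kernel.
Context {R : realType}.
Local Notation leb := (@lebesgue_measure R).
Implicit Types c x y : R.

Definition expNabs c x : R := expR (- (c * `|x|)).

Lemma expNabs_ge0 c x : 0 <= expNabs c x.
Proof. exact: expR_ge0. Qed.

Lemma expNabs_le1 c x : 0 <= c -> expNabs c x <= 1.
Proof. by move=> c0; rewrite -expR0 ler_expR oppr_le0 mulr_ge0. Qed.

Lemma measurable_expNabs c : measurable_fun setT (expNabs c).
Proof.
apply: measurableT_comp => //; apply: measurableT_comp => //.
by apply: measurable_funM => //; exact: measurableT_comp.
Qed.

Lemma continuous_expNabs c : continuous (expNabs c).
Proof.
move=> x; apply: (@cvg_comp _ _ _ (fun y => - (c * `|y|)) expR); last first.
  exact: continuous_expR.
apply: cvgN; apply: cvgM; first exact: cvg_cst.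
exact: norm_continuous.
Qed.

(** This is the triangle inequality in the exponent, and the base case of the bound carried to every
    u_k. *)
Lemma expNabs_translation c x y : 0 <= c ->
  expNabs c y * expNabs c x <= expNabs c (y + x).
Proof.
move=> c0; rewrite -expRD ler_expR -opprD lerN2 -mulrDr ler_wpM2l//.
exact: ler_normD.
Qed.

(** By symmetry the integral is twice that over the half-line, where the kernel is [c^-1] times the
    exponential probability density. *)
Lemma integral_expNabs_lty c : 0 < c -> (\int[leb]_x (expNabs c x)%:E < +oo)%E.
Proof.
move=> c0; rewrite ge0_symfun_integralT; last 3 first.
- exact: expNabs_ge0.
- exact: continuous_expNabs.
- by move=> x; rewrite /expNabs/= normrN.
apply: lte_mul_pinfty => //.
rewrite integral_mkcond (_ : _ \_ _ =
    (fun x => c^-1%:E * (exponential_pdf c x)%:E)%E); last first.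
  apply/funext => x; rewrite /exponential_pdf !patchE.
  have [x0|x0] := leP 0 x; last first.
    by rewrite !memNset ?mule0//= ?in_itv/= leNgt x0.
  rewrite !mem_set//= ?in_itv/= ?x0// -EFinM mulKf ?gt_eqF//= /expNabs.
  by rewrite mulNr ger0_norm.
rewrite ge0_integralZl//.
- by rewrite integral_exponential_pdf// mule1 ltry.
- by apply/measurable_EFinP; exact: measurable_exponential_pdf.
- by move=> x _; rewrite lee_fin exponential_pdf_ge0// ltW.
- by rewrite lee_fin invr_ge0 ltW.
Qed.

Lemma integral_expNabs_gt0 c : (0 < \int[leb]_x (expNabs c x)%:E)%E.
Proof.
(* On [0, 1] the kernel is at least e^(-|c|), whatever the sign of [c]. *)
apply: (@lt_le_trans _ _ (\int[leb]_x (\1_`[0, 1] x * expR (- `|c|))%:E)%E).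
  rewrite (_ : (fun _ => _) =
      (fun x => (expR (- `|c|))%:E * (\1_`[0, 1] x)%:E)%E).
    rewrite ge0_integralZl//=.
    - rewrite integral_indic// setIT /= lebesgue_measure_itv/= lte_fin ltr01.
      by rewrite sube0 mule1 lte_fin expR_gt0.
    - exact/measurable_EFinP.
  by apply/funext => x; rewrite -EFinM mulrC.
apply: ge0_le_integral => //.
- apply/measurable_EFinP; apply: measurable_funM => //.
- by apply/measurable_EFinP; exact: measurable_expNabs.
move=> x _; rewrite lee_fin indicE; have [|_] := boolP (x \in _); last first.
  by rewrite mul0r expNabs_ge0.
rewrite inE/= in_itv/= => /andP[x0 x1]; rewrite mul1r ler_expR lerN2.
rewrite (le_trans (ler_norm _))// normrM normr_id (ger0_norm x0).
by rewrite ler_piMr.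
Qed.


(** For c = 1/(n+1) the kernels increase to 1, so by monotone convergence the integrals tend to that
    of [a] and eventually exceed [B]. *)
Lemma integral_mul_expNabs_gt (a : R -> \bar R) (B : \bar R) :
  measurable_fun setT a -> (forall x, 0 <= a x)%E ->
  (forall x, a x \is a fin_num) ->
  (B < \int[leb]_x a x)%E ->
  exists2 c : R, 0 < c & (B < \int[leb]_x (a x * (expNabs c x)%:E))%E.
Proof.
move=> ma a0 afin BA.
pose g n x := (a x * (expNabs n.+1%:R^-1 x)%:E)%E.
have mg n : measurable_fun setT (g n).
  apply: emeasurable_funM => //; apply/measurable_EFinP.
  exact: measurable_expNabs.
have g0 n x : setT x -> (0 <= g n x)%E.
  by move=> _; rewrite mule_ge0// lee_fin expNabs_ge0.
have ndg x : setT x -> {homo g^~ x : n m / (n <= m)%N >-> (n <= m)%E}.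
  move=> _ n m nm; rewrite lee_wpmul2l// lee_fin ler_expR lerN2.
  by rewrite ler_wpM2r// lef_pV2 ?posrE// ler_nat.
have cvgg := cvg_monotone_convergence (mu := leb) measurableT mg g0 ndg.
have limg : (\int[leb]_x limn (g^~ x) = \int[leb]_x a x)%E.
  apply: eq_integral => x _; apply: cvg_lim => //.
  rewrite -[X in _ --> X]mule1; apply: cvgeZl => //.
  apply: cvg_EFin; first exact: nearW.
  have cvg0 : - (n.+1%:R^-1 * `|x|) @[n --> \oo] --> (0 : R).
    rewrite -oppr0 -(mul0r `|x|); apply: cvgN; apply: cvgM; last exact: cvg_cst.
    exact: cvg_harmonic.
  rewrite -[X in _ --> X]expR0.
  exact: (cvg_comp _ _ cvg0 (@continuous_expR R 0)).
rewrite limg in cvgg.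
have [n _ Bn] : \forall n \near \oo, (B < \int[leb]_x g n x)%E.
  exact: (cvgg _ (open_ereal_gt' BA)).
by exists n.+1%:R^-1 => //; exact: Bn (leqnn n).
Qed.

End exponential_kernel.

Section polynomial_weight.
Context {R : realType}.
Implicit Types e x y : R.

(** The order of the moment is [n]. The scale e = 1 is used to express moments, a small [e] to make
    the series of integrals converge. *)
Definition weight n e x : R := (1 + e * `|x|) ^+ n.

Lemma weight_ge0 n e x : 0 <= e -> 0 <= weight n e x.
Proof. by move=> e0; rewrite exprn_ge0// addr_ge0// mulr_ge0. Qed.

Lemma measurable_weight n e : measurable_fun setT (weight n e).
Proof.
apply: measurable_funX; apply: measurable_funD => //.
by apply: measurable_funM => //; exact: measurableT_comp.
Qed.

(* Submultiplicativity, written with [x = (y + x) - y]. *)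
Lemma weight_translation n e x y : 0 <= e ->
  weight n e x <= weight n e y * weight n e (y + x).
Proof.
move=> e0; rewrite -exprMn lerXn2r ?nnegrE//.
- by rewrite addr_ge0// mulr_ge0.
- by rewrite mulr_ge0// addr_ge0// mulr_ge0.
have xy : `|x| <= `|y| + `|y + x|.
  by rewrite -{1}(addKr y x) (le_trans (ler_normD _ _))// normrN.
have := ler_wpM2l e0 xy.
have := mulr_ge0 (mulr_ge0 e0 (normr_ge0 y)) (mulr_ge0 e0 (normr_ge0 (y + x))).
lra.
Qed.

(** As a function of [e] the weight is convex on [0, 1], hence below its chord. An integral against
    [weight n e] thus approaches the unweighted one as [e] tends to 0. *)
Lemma weight_le_convex n e x : 0 <= e <= 1 ->
  weight n e x <= 1 + e * weight n 1 x.
Proof.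
move=> /andP[e0 e1]; rewrite /weight mul1r.
have : 0 <= `|x| by [].
move: `|x| => {}x x0.
suff : (1 + e * x) ^+ n <= 1 - e + e * (1 + x) ^+ n.
  by move=> /le_trans; apply; rewrite lerD2r gerBl.
elim: n => [|n IH]; first by rewrite !expr0 mulr1 subrK.
have p1 : 1 <= (1 + x) ^+ n by rewrite exprn_ege1// lerDl.
rewrite exprS (le_trans (ler_wpM2l _ IH))//.
  by rewrite addr_ge0// mulr_ge0.
rewrite [(1 + x) ^+ n.+1]exprS; move: ((1 + x) ^+ n) p1 => p p1.
(* This product is exactly the difference of the two sides of the goal. *)
have : 0 <= e * x * (p - 1) * (1 - e).
  by rewrite !mulr_ge0// subr_ge0.
nra.
Qed.

(** From e(1 + |x|) <= 1 + e|x|. It brings finiteness back from the small scale to scale 1. *)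
Lemma weight1_le n e x : 0 <= e <= 1 -> e ^+ n * weight n 1 x <= weight n e x.
Proof.
move=> /andP[e0 e1]; rewrite -exprMn lerXn2r ?nnegrE//.
- by rewrite mulr_ge0// addr_ge0// mulr_ge0.
- by rewrite addr_ge0// mulr_ge0.
by rewrite mulrDr mulr1 mul1r lerD2r.
Qed.

Lemma weight_le_expR n e x : 0 <= e -> weight n e x <= expR (n%:R * e * `|x|).
Proof.
move=> e0; rewrite -mulrA expRM_natl lerXn2r ?nnegrE ?expR_ge0//.
- by rewrite addr_ge0// mulr_ge0.
- exact: expR_ge1Dx.
Qed.

End polynomial_weight.

Lemma lee_expn2r (R : realDomainType) n (x y : \bar R) :
  (0 <= x -> x <= y -> x ^+ n <= y ^+ n)%E.
Proof.
move=> x0 xy; elim: n => [|n IH]; first by rewrite !expe0.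
by rewrite !expeS; apply: lee_pmul => //; exact: expe_ge0.
Qed.

(** * The smoothing density as a Neumann series *)

Section smoothing_density.
Context {R : realType}.
Local Notation leb := (@lebesgue_measure R).
Local Open Scope ereal_scope.
Variables (b : R -> \bar R) (S c : R).
Hypotheses (mb : measurable_fun setT b) (b0 : forall x, 0 <= b x)
  (bfin : forall x, b x \is a fin_num).
Hypotheses (S0 : (0 < S)%R) (c0 : (0 < c)%R).

(** The argument [y + t] makes each step a convolution with the reflection of [b], in accordance
    with the sign in Z = -V. *)
Fixpoint convol_iter k : R -> \bar R :=
  if k is k'.+1 then
    fun t => (S^-1)%:E * \int[leb]_y (b y * convol_iter k' (y + t)%R)
  else fun t => (expNabs c t)%:E.

(** Neumann series of the operator sending v to S^-1 \int b(y) v(y + t) dy, applied to u_0. It takes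
    extended real values and is normalised only when the noise is built. *)
Definition smoothing_density t := \sum_(k <oo) convol_iter k t.

Local Notation u := convol_iter.
Local Notation h := smoothing_density.

Let S_ge0 : 0 <= S^-1%:E.
Proof. by rewrite lee_fin invr_ge0 ltW. Qed.

Lemma convol_iter_ge0 k t : 0 <= u k t.
Proof.
elim: k t => [|k IH] t /=; first by rewrite lee_fin expNabs_ge0.
by rewrite mule_ge0//; apply: integral_ge0 => y _; rewrite mule_ge0.
Qed.

Let measurable_mul_translation (f g : R -> \bar R) : measurable_fun setT f ->
  measurable_fun setT g ->
  measurable_fun setT
    (fun p : measurableTypeR R * measurableTypeR R => f p.2 * g (p.2 + p.1)%R).
Proof.
move=> mf mg; apply: emeasurable_funM; first exact: measurableT_comp.
by apply: (measurableT_comp mg); exact: measurable_funD.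
Qed.

Lemma measurable_convol_iter k : measurable_fun setT (u k).
Proof.
elim: k => [|k IH] /=.
  by apply/measurable_EFinP; exact: measurable_expNabs.
apply: emeasurable_funM; first exact: measurable_cst.
apply: (measurable_fun_fubini_tonelli_F (m2 := leb)
  (fun p : measurableTypeR R * measurableTypeR R => b p.2 * u k (p.2 + p.1)%R)).
- exact: measurable_mul_translation.
- by move=> p; rewrite mule_ge0// convol_iter_ge0.
Qed.

Lemma smoothing_density_ge0 t : 0 <= h t.
Proof. by apply: nneseries_ge0 => k _ _; exact: convol_iter_ge0. Qed.

Lemma measurable_smoothing_density : measurable_fun setT h.
Proof.
apply: ge0_emeasurable_sum => [k x _ _|k _]; first exact: convol_iter_ge0.
exact: measurable_convol_iter.
Qed.

Let measurable_translation (f : R -> \bar R) (t : R) : measurable_fun setT f ->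
  measurable_fun setT (fun y : R => f (y + t)%R).
Proof.
move=> mf; apply: (measurableT_comp mf).
by apply: measurable_funD.
Qed.

Let measurable_translationl (f : R -> \bar R) (t : R) : measurable_fun setT f ->
  measurable_fun setT (fun y : R => f (t + y)%R).
Proof.
move=> mf; apply: (measurableT_comp mf).
by apply: measurable_funD.
Qed.

(** By induction: the factor enters the integral over x, and the bound for u_k is applied at the
    point [x + t] with the same shift [y]. *)
Lemma convol_iter_translation k y t :
  (expNabs c y)%:E * u k t <= u k (y + t)%R.
Proof.
elim: k y t => [|k IH] y t /=.
  by rewrite -EFinM lee_fin expNabs_translation// ltW.
rewrite muleCA lee_wpmul2l// -ge0_integralZl//; last 3 first.
- apply: emeasurable_funM => //; apply: measurable_translation.
  exact: measurable_convol_iter.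
- by move=> x _; rewrite mule_ge0// convol_iter_ge0.
- by rewrite lee_fin expNabs_ge0.
apply: ge0_le_integral => //.
- move=> x _; rewrite mule_ge0 ?lee_fin ?expNabs_ge0//.
  by rewrite mule_ge0// convol_iter_ge0.
- apply: emeasurable_funM; first exact: measurable_cst.
  apply: emeasurable_funM => //; apply: measurable_translation.
  exact: measurable_convol_iter.
- apply: emeasurable_funM => //; apply: measurable_translation.
  exact: measurable_convol_iter.
move=> x _; rewrite muleCA lee_wpmul2l//.
by rewrite (addrCA x); exact: IH.
Qed.

Lemma smoothing_density_translation y t :
  (expNabs c y)%:E * h t <= h (y + t)%R.
Proof.
rewrite -nneseriesZl; last by move=> k _; exact: convol_iter_ge0.
apply: lee_nneseries => k _; last exact: convol_iter_translation.
by rewrite mule_ge0 ?convol_iter_ge0// lee_fin expNabs_ge0.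
Qed.

(** Integrating term by term turns u_k into S u_(k+1), so the left side is S times the series
    deprived of its nonnegative term u_0. *)
Lemma convol_smoothing_density_le t :
  \int[leb]_y (b y * h (y + t)%R) <= S%:E * h t.
Proof.
have -> : \int[leb]_y (b y * h (y + t)%R) = S%:E * \sum_(k <oo) u k.+1 t.
  rewrite -nneseriesZl; last by move=> k _; exact: convol_iter_ge0.
  under eq_eseriesr => k _ do
    rewrite /= muleA -EFinM divff ?gt_eqF// mul1e.
  rewrite -integral_nneseries//; last 2 first.
  - move=> k; apply: emeasurable_funM => //; apply: measurable_translation.
    exact: measurable_convol_iter.
  - by move=> k x _; rewrite mule_ge0// convol_iter_ge0.
  apply: eq_integral => y _; rewrite -(fineK (bfin y)) nneseriesZl//.
  by move=> k _; exact: convol_iter_ge0.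
rewrite lee_pmul2l//.
rewrite /smoothing_density [leRHS](nneseries_split _ 1)//; last first.
  by move=> k _; exact: convol_iter_ge0.
rewrite -[X in _ <= _ + X]nneseries_addn; last first.
  by move=> k; exact: convol_iter_ge0.
rewrite add0n; under [X in _ <= _ + X]eq_eseriesr do rewrite addn1.
by apply: leeDr; rewrite big_nat1 convol_iter_ge0.
Qed.

(** The translation bound replaces [h (y + t)] by e^(-c|y|) h(t); the factor h(t) then leaves the
    integral, and what remains is at least [S]. *)
Lemma smoothing_density_convol_ge (a : R -> \bar R) t :
  measurable_fun setT a -> (forall x, 0 <= a x) ->
  S%:E <= \int[leb]_y (a y * (expNabs c y)%:E) ->
  S%:E * h t <= \int[leb]_y (a y * h (y + t)%R).
Proof.
move=> ma a0 Sa.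
apply: (@le_trans _ _ ((\int[leb]_y (a y * (expNabs c y)%:E)) * h t)).
  by rewrite lee_wpmul2r ?smoothing_density_ge0.
have mae : measurable_fun setT (fun y => a y * (expNabs c y)%:E).
  apply: emeasurable_funM => //; apply/measurable_EFinP.
  exact: measurable_expNabs.
rewrite -ge0_integralZr//; last 2 first.
- by move=> y _; rewrite mule_ge0// lee_fin expNabs_ge0.
- exact: smoothing_density_ge0.
apply: ge0_le_integral => //.
- move=> y _; rewrite mule_ge0 ?smoothing_density_ge0//.
  by rewrite mule_ge0// lee_fin expNabs_ge0.
- exact: emeasurable_funM.
- apply: emeasurable_funM => //; apply: measurable_translation.
  exact: measurable_smoothing_density.
move=> y _; rewrite -muleA lee_wpmul2l//.
exact: smoothing_density_translation.
Qed.

(** Submultiplicativity shares the weight between [b] and u_k, so each iteration multiplies the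
    weighted integral by at most the same ratio. *)
Lemma integral_weight_convol_iter n e k : (0 <= e)%R ->
  \int[leb]_t ((weight n e t)%:E * u k t) <=
  (S^-1%:E * \int[leb]_y ((weight n e y)%:E * b y)) ^+ k *
  \int[leb]_t ((weight n e t)%:E * (expNabs c t)%:E).
Proof.
move=> e0; pose W x := (weight n e x)%:E.
have W0 x : 0 <= W x by rewrite lee_fin weight_ge0.
have mW : measurable_fun setT W.
  by apply/measurable_EFinP; exact: measurable_weight.
have Wu0 j x : 0 <= W x * u j x by rewrite mule_ge0// convol_iter_ge0.
have mWu j : measurable_fun setT (fun x => W x * u j x).
  by apply: emeasurable_funM => //; exact: measurable_convol_iter.
elim: k => [|k IH]; first by rewrite expe0 mul1e.
apply: (@le_trans _ _ ((S^-1%:E * \int[leb]_y (W y * b y)) *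
    \int[leb]_t (W t * u k t))); last first.
  rewrite expeS -[leRHS]muleA; apply: lee_wpmul2l => //; rewrite mule_ge0//.
  by apply: integral_ge0 => y _; rewrite mule_ge0.
pose f (p : measurableTypeR R * measurableTypeR R) :=
  (W p.2 * b p.2) * (W (p.2 + p.1)%R * u k (p.2 + p.1)%R).
have mf : measurable_fun setT f.
  apply: (measurable_mul_translation (f := fun x => W x * b x)
    (g := fun x => W x * u k x)) => //.
  exact: emeasurable_funM.
have f0 p : 0 <= f p by rewrite mule_ge0// mule_ge0.
(* When [t] is integrated first, translation invariance removes the shift by [y] and the double
   integral of [f] factors. *)
have -> : S^-1%:E * \int[leb]_y (W y * b y) * \int[leb]_t (W t * u k t) =
    S^-1%:E * \int[leb]_t \int[leb]_y f (t, y).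
  rewrite -muleA (fubini_tonelli _ mf f0); congr (_ * _).
  rewrite -ge0_integralZr//; last 3 first.
  - exact: emeasurable_funM.
  - by move=> y _; rewrite mule_ge0.
  - by apply: integral_ge0 => t _; exact: Wu0.
  apply: eq_integral => y _.
  rewrite /f/= ge0_integralZl//; last 2 first.
  - exact: (@measurable_translationl (fun x => W x * u k x) y (mWu k)).
  - by rewrite mule_ge0.
  congr (_ * _); under [RHS]eq_integral => x _ do rewrite (addrC y x).
  by rewrite (ge0_integral_translation (f := fun x => W x * u k x)).
rewrite -ge0_integralZl//; last 2 first.
- exact: (measurable_fun_fubini_tonelli_F (m2 := leb) f).
- by move=> t _; apply: integral_ge0.
apply: ge0_le_integral => //.
- by move=> t _; exact: Wu0.
- exact: mWu.
- apply: emeasurable_funM; first exact: measurable_cst.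
  exact: (measurable_fun_fubini_tonelli_F (m2 := leb) f).
move=> t _ /=; rewrite muleCA; apply: lee_wpmul2l => //.
have mbu : measurable_fun setT (fun y => b y * u k (y + t)%R).
  apply: emeasurable_funM => //; apply: measurable_translation.
  exact: measurable_convol_iter.
rewrite -ge0_integralZl//; last 2 first.
- by move=> y _; rewrite mule_ge0// convol_iter_ge0.
- exact: W0.
apply: ge0_le_integral => //.
- by move=> y _; rewrite mule_ge0 ?W0// mule_ge0// convol_iter_ge0.
- exact: emeasurable_funM.
- apply: emeasurable_funM; first exact: emeasurable_funM.
  exact: (@measurable_translation (fun x => W x * u k x) t (mWu k)).
move=> y _; rewrite /f/= muleACA lee_wpmul2r//.
  by rewrite mule_ge0// convol_iter_ge0.
by rewrite -EFinM lee_fin weight_translation.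
Qed.

(** The weighted integrals of the u_k are bounded by a geometric sequence of ratio [r]. *)
Lemma integral_weight_smoothing_density n e r : (0 <= e)%R ->
  (n%:R * e <= c / 2)%R -> (0 <= r < 1)%R ->
  S^-1%:E * \int[leb]_y ((weight n e y)%:E * b y) <= r%:E ->
  \int[leb]_t ((weight n e t)%:E * h t) < +oo.
Proof.
move=> e0 ne /andP[r0 r1] Wbr.
have mW : measurable_fun setT (fun t => (weight n e t)%:E).
  by apply/measurable_EFinP; exact: measurable_weight.
have W0 t : 0 <= (weight n e t)%:E by rewrite lee_fin weight_ge0.
have mWu k : measurable_fun setT (fun t => (weight n e t)%:E * u k t).
  by apply: emeasurable_funM => //; exact: measurable_convol_iter.
have Wu0 k t : 0 <= (weight n e t)%:E * u k t.
  by rewrite mule_ge0// convol_iter_ge0.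
pose C := \int[leb]_t ((weight n e t)%:E * (expNabs c t)%:E).
have C0 : 0 <= C.
  by apply: integral_ge0 => t _; rewrite mule_ge0// lee_fin expNabs_ge0.
(* The weight is at most e^(ne|t|), and ne <= c/2 leaves half of the decay rate of the kernel. *)
have Coo : C < +oo.
  apply: le_lt_trans (integral_expNabs_lty (divr_gt0 c0 (ltr0Sn _ 1))).
  apply: ge0_le_integral => //.
  - by move=> t _; rewrite mule_ge0// lee_fin expNabs_ge0.
  - exact: (mWu 0%N).
  - by apply/measurable_EFinP; exact: measurable_expNabs.
  move=> t _; rewrite -EFinM lee_fin.
  apply: (@le_trans _ _ (expR (n%:R * e * `|t|) * expNabs c t)%R).
    by rewrite ler_wpM2r ?expNabs_ge0// weight_le_expR.
  rewrite -expRD ler_expR.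
  have := ler_wpM2r (normr_ge0 t) ne.
  lra.
have Cfin : C \is a fin_num by rewrite ge0_fin_numE.
have -> : \int[leb]_t ((weight n e t)%:E * h t) =
    \sum_(k <oo) \int[leb]_t ((weight n e t)%:E * u k t).
  rewrite -integral_nneseries//; apply: eq_integral => t _.
  by rewrite nneseriesZl// => k _; exact: convol_iter_ge0.
apply: (@le_lt_trans _ _ (\sum_(k <oo) (fine C * r ^+ k)%:E)).
  apply: lee_nneseries => [k _ _|k _].
    by apply: integral_ge0 => t _; exact: Wu0.
  apply: (le_trans (integral_weight_convol_iter n k e0)).
  rewrite EFinM fineK// muleC lee_wpmul2l// EFin_expe.
  apply: lee_expn2r => //.
  rewrite mule_ge0//; apply: integral_ge0 => y _; exact: mule_ge0.
rewrite (_ : limn _ = (fine C / (1 - r))%:E) ?ltry//.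
apply: cvg_lim => //.
rewrite (_ : (fun _ => _) = EFin \o series (geometric (fine C) r)).
  apply: cvg_EFin; first exact: nearW.
  by apply: cvg_geometric_series; rewrite ger0_norm.
by apply/funext => k; rewrite /= /series /geometric /= sumEFin.
Qed.

End smoothing_density.

Section smoothing_density_existence.
Context {R : realType}.
Local Notation leb := (@lebesgue_measure R).
Local Open Scope ereal_scope.
Variables a b : R -> \bar R.
Hypotheses (ma : measurable_fun setT a) (mb : measurable_fun setT b).
Hypotheses (a0 : forall x, 0 <= a x) (b0 : forall x, 0 <= b x).
Hypotheses (afin : forall x, a x \is a fin_num)
  (bfin : forall x, b x \is a fin_num).
Hypotheses (iafin : \int[leb]_x a x \is a fin_num)
  (ibfin : \int[leb]_x b x \is a fin_num).

(** The fourth clause compares both sides with S h(t). The last clause serves twice: for n = 0 the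
    weight is 1 and it gives integrability of [h]; for general [n] it gives the moments of the
    noise. *)
Lemma smoothing_density_exists : \int[leb]_x b x < \int[leb]_x a x ->
  exists h : R -> \bar R,
    [/\ measurable_fun setT h, (forall t, 0 <= h t), 0 < \int[leb]_t h t,
        (forall t : R, \int[leb]_y (b y * h (y + t)%R) <=
                       \int[leb]_y (a y * h (y + t)%R)) &
        forall n, \int[leb]_y ((weight n 1 y)%:E * b y) < +oo ->
          \int[leb]_t ((weight n 1 t)%:E * h t) < +oo].
Proof.
move=> /(integral_mul_expNabs_gt ma a0 afin)[c c0].
set Sc := \int[leb]_x (a x * (expNabs c x)%:E) => BS.
have mac : measurable_fun setT (fun x => a x * (expNabs c x)%:E).
  apply: emeasurable_funM => //; apply/measurable_EFinP.
  exact: measurable_expNabs.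
have Scfin : Sc \is a fin_num.
  rewrite ge0_fin_numE; last first.
    by apply: integral_ge0 => x _; rewrite mule_ge0// lee_fin expNabs_ge0.
  apply: (@le_lt_trans _ _ (\int[leb]_x a x)); last by rewrite ltey_eq iafin.
  apply: ge0_le_integral => //.
    by move=> x _; rewrite mule_ge0// lee_fin expNabs_ge0.
  move=> x _; rewrite -[leRHS]mule1 lee_wpmul2l//.
  by rewrite lee_fin expNabs_le1// ltW.
pose S := fine Sc; pose B := fine (\int[leb]_x b x).
have BE : \int[leb]_x b x = B%:E by rewrite fineK.
have SE : Sc = S%:E by rewrite fineK.
have {}BS : (B < S)%R by rewrite -lte_fin -BE -SE.
have B0 : (0 <= B)%R by rewrite -lee_fin -BE; exact: integral_ge0.
have S0 : (0 < S)%R by exact: le_lt_trans BS.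
exists (smoothing_density b S c); split.
- exact: measurable_smoothing_density.
- exact: smoothing_density_ge0.
- apply: (lt_le_trans (integral_expNabs_gt0 c)).
  apply: ge0_le_integral => //.
  + by move=> t _; rewrite lee_fin expNabs_ge0.
  + by apply/measurable_EFinP; exact: measurable_expNabs.
  + exact: measurable_smoothing_density.
  move=> t _; rewrite /smoothing_density (nneseries_split _ 1)//; last first.
    by move=> k _; exact: convol_iter_ge0.
  rewrite add0n big_nat1 leeDl// nneseries_ge0// => k _ _.
  exact: convol_iter_ge0.
- move=> t; apply: (le_trans (convol_smoothing_density_le _ _ _ _ _ _)) => //.
  apply: smoothing_density_convol_ge => //.
  by rewrite -SE.
move=> n; set M := \int[leb]_y _ => Moo.
have mW e : measurable_fun setT (fun t : R => (weight n e t)%:E).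
  by apply/measurable_EFinP; exact: measurable_weight.
have M0 : 0 <= M.
  by apply: integral_ge0 => y _; rewrite mule_ge0// lee_fin weight_ge0.
have ME : M = (fine M)%:E by rewrite fineK// ge0_fin_numE.
have fM0 : (0 <= fine M)%R by exact: fine_ge0.
(* The bound 1 is for convexity, the second gives ne <= c/2, and the third gives eM <= (S - B)/2.
   The added units keep the denominators positive. *)
pose e : R :=
  Num.min 1%R (Num.min (c / 2 / n.+1%:R) ((S - B) / 2 / (fine M + 1)))%R.
have e0 : (0 < e)%R.
  rewrite !lt_min ltr01 !divr_gt0//= ?subr_gt0// ltr_pwDr//.
have e1 : (e <= 1)%R by rewrite ge_min lexx.
have e01 : (0 <= e <= 1)%R by rewrite e1 ltW.
have ec : (n%:R * e <= c / 2)%R.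
  apply: (@le_trans _ _ (n.+1%:R * e)%R).
    by rewrite ler_wpM2r ?ler_nat// ltW.
  rewrite mulrC -ler_pdivlMr//.
  by rewrite /e !ge_min lexx !orbT.
have eM : (e * fine M <= (S - B) / 2)%R.
  apply: (@le_trans _ _ (e * (fine M + 1))%R).
    by rewrite ler_wpM2l ?lerDl// ltW.
  rewrite -ler_pdivlMr ?ltr_pwDr//.
  by rewrite /e !ge_min lexx !orbT.
have h0 := smoothing_density_ge0 c b0 S0.
have mh := measurable_smoothing_density c mb b0 S0.
(* The weighted integral of [b] is at most B + eM, hence at most the midpoint of [B] and [S];
   dividing by [S] gives a ratio below 1. *)
have We : \int[leb]_t ((weight n e t)%:E * smoothing_density b S c t) < +oo.
  apply: (@integral_weight_smoothing_density _ b S c mb b0 S0 c0 n e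
    ((B + (S - B) / 2) / S)%R) => //.
  - exact: ltW.
  - apply/andP; split; first by rewrite divr_ge0//; lra.
    by rewrite ltr_pdivrMr// mul1r; lra.
  rewrite mulrC EFinM lee_wpmul2l//; first by rewrite lee_fin invr_ge0 ltW.
  apply: (@le_trans _ _ (\int[leb]_y (b y + e%:E * ((weight n 1 y)%:E * b y)))).
    apply: ge0_le_integral => //.
    + by move=> y _; rewrite mule_ge0// lee_fin weight_ge0// ltW.
    + exact: emeasurable_funM (mW _) mb.
    + apply: emeasurable_funD => //; apply: emeasurable_funM => //.
      exact: emeasurable_funM (mW _) mb.
    move=> y _; rewrite muleA -[X in X + _]mul1e -ge0_muleDl//; last first.
      by rewrite mule_ge0// lee_fin ?weight_ge0// ltW.
    by rewrite lee_wpmul2r// -EFinM -EFinD lee_fin weight_le_convex.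
  have mWb : measurable_fun setT (fun y : R => (weight n 1 y)%:E * b y).
    exact: emeasurable_funM (mW _) mb.
  have Wb0 y : 0 <= (weight n 1 y)%:E * b y.
    by rewrite mule_ge0// lee_fin weight_ge0.
  rewrite ge0_integralD//; last 2 first.
  - by move=> y _; rewrite mule_ge0// lee_fin ltW.
  - by apply: emeasurable_funM.
  rewrite ge0_integralZl//; last by rewrite lee_fin ltW.
  by rewrite -/M BE ME -EFinM -EFinD lee_fin lerD2l.
apply: (@le_lt_trans _ _ ((e ^+ n)^-1%:E *
    \int[leb]_t ((weight n e t)%:E * smoothing_density b S c t))); last first.
  by rewrite lte_mul_pinfty// lee_fin invr_ge0 exprn_ge0// ltW.
have en0 : 0 <= (e ^+ n)^-1%:E by rewrite lee_fin invr_ge0 exprn_ge0// ltW.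
have We0 t : 0 <= (weight n e t)%:E * smoothing_density b S c t.
  by rewrite mule_ge0// lee_fin weight_ge0// ltW.
rewrite -ge0_integralZl//; last exact: emeasurable_funM (mW _) mh.
apply: ge0_le_integral => //.
- by move=> t _; rewrite mule_ge0// lee_fin weight_ge0.
- exact: emeasurable_funM (mW _) mh.
- by apply: emeasurable_funM => //; exact: emeasurable_funM (mW _) mh.
move=> t _; rewrite muleA lee_wpmul2r// -EFinM lee_fin.
by rewrite mulrC ler_pdivlMr ?exprn_gt0// mulrC weight1_le.
Qed.

End smoothing_density_existence.

(** * The noise *)

Section gap_moments.
Context d (T : measurableType d) (R : realType) (P : probability T R).
Local Notation leb := (@lebesgue_measure R).
Local Open Scope ereal_scope.

(** From 1 + |x| <= 2 max(1, |x|). *)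
Lemma weight1_le_pow n (x : R) : (weight n 1 x <= 2 ^+ n * (1 + `|x| ^+ n))%R.
Proof.
rewrite /weight mul1r; have [x1|x1] := leP `|x|%R 1%R.
  rewrite -[leLHS]mulr1 ler_pM ?exprn_ge0 ?addr_ge0//; last first.
    by rewrite lerDl exprn_ge0.
  by rewrite lerXn2r ?nnegrE ?addr_ge0//; lra.
apply: (@le_trans _ _ (2 ^+ n * `|x| ^+ n)%R); last first.
  by rewrite ler_wpM2l ?exprn_ge0// lerDr.
rewrite -exprMn lerXn2r ?nnegrE ?addr_ge0 ?mulr_ge0//; lra.
Qed.

Lemma integral_weight_lty (X : {RV P >-> R}) n : all_moments_finite X ->
  \int[P]_t (weight n 1 (X t))%:E < +oo.
Proof.
move=> /(_ n); rewrite unlock => Xn.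
have mX : measurable_fun setT (fun t => (`|X t| ^+ n)%:E).
  apply/measurable_EFinP; apply: measurable_funX.
  exact: measurableT_comp.
have X0 t : 0 <= (`|X t| ^+ n)%:E by rewrite lee_fin exprn_ge0.
apply: (@le_lt_trans _ _ (\int[P]_t ((2 ^+ n)%:E * (1 + (`|X t| ^+ n)%:E)))).
  apply: ge0_le_integral => //.
  - by move=> t _; rewrite lee_fin weight_ge0.
  - apply/measurable_EFinP; apply: (measurableT_comp (measurable_weight n 1)).
    exact: measurable_funPT.
  - apply: emeasurable_funM => //; exact: emeasurable_funD.
  by move=> t _; rewrite -EFinD -EFinM lee_fin weight1_le_pow.
rewrite ge0_integralZl//; last 2 first.
- exact: emeasurable_funD.
- by move=> t _; rewrite adde_ge0.
rewrite lte_mul_pinfty ?lee_fin ?exprn_ge0//.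
have P1 : \int[P]_t (1 : \bar R) = 1.
  by rewrite integral_cst// mul1e; exact: probability_setT.
by rewrite ge0_integralD// P1 lte_add_pinfty// ltry.
Qed.

(** By Tonelli this is the expectation of the integral of the weight over [X, Y[. With m = max(|X|,
    |Y|), the weight there is at most (1 + m)^n and the length at most 2(1 + m), so moments of order
    n + 1 suffice. *)
Lemma integral_weight_gap_lty (X Y : {RV P >-> R}) n :
  all_moments_finite X -> all_moments_finite Y ->
  \int[leb]_z ((weight n 1 z)%:E * gap X Y z) < +oo.
Proof.
move=> mX mY; under eq_integral do rewrite muleC.
have W0 m z : 0 <= (weight m 1 z : R)%:E by rewrite lee_fin weight_ge0.
have mW m : measurable_fun setT (fun t : R => (weight m 1 t)%:E).
  by apply/measurable_EFinP; exact: measurable_weight.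
have mWX m (Z : {RV P >-> R}) :
    measurable_fun setT (fun t => (weight m 1 (Z t))%:E).
  by apply: (measurableT_comp (mW m)).
rewrite ge0_integral_gap//.
apply: (@le_lt_trans _ _ (\int[P]_t (2%:E *
    ((weight n.+1 1 (X t))%:E + (weight n.+1 1 (Y t))%:E)))); last first.
  rewrite ge0_integralZl//; last 2 first.
  - exact: emeasurable_funD.
  - by move=> t _; rewrite adde_ge0.
  rewrite lte_mul_pinfty// ge0_integralD//.
  by rewrite lte_add_pinfty// integral_weight_lty.
apply: ge0_le_integral => //.
- by move=> t _; apply: integral_ge0.
- exact: measurable_integral_itv (mW _) (W0 _).
- by apply: emeasurable_funM => //; exact: emeasurable_funD.
move=> t _.
have [YX|XY] := leP (Y t) (X t).
  rewrite set_itv_ge ?integral_set0 -?leNgt ?bnd_simp//.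
  by rewrite mule_ge0// adde_ge0.
pose m := Num.max `|X t|%R `|Y t|%R.
have m0 : (0 <= m)%R by rewrite le_max normr_ge0.
have wnorm (y : R) : weight n.+1 1 `|y|%R = weight n.+1 1 y.
  by rewrite /weight normr_id.
have Wm : (weight n.+1 1 m <= weight n.+1 1 (X t) + weight n.+1 1 (Y t))%R.
  rewrite /m; have [_|_] := leP `|X t|%R `|Y t|%R;
    by rewrite wnorm ?lerDl ?lerDr weight_ge0.
apply: (@le_trans _ _ (\int[leb]_(z in `[X t, Y t[) (weight n 1 m)%:E)).
  apply: ge0_le_integral => //.
  - exact: measurable_funTS (mW _).
  move=> z /=; rewrite in_itv/= => /andP[Xz zY].
  rewrite lee_fin /weight lerXn2r ?nnegrE ?addr_ge0 ?mulr_ge0//.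
  rewrite lerD2l !mul1r (ger0_norm m0) ler_norml le_max.
  have := ler_norm (Y t); have := ler_norm (- X t)%R; rewrite normrN => ? ?.
  rewrite {1}/m; apply/andP; split; last by apply/orP; right; lra.
  rewrite lerNl le_max; apply/orP; left; lra.
rewrite integral_cst//= lebesgue_measure_itv/= lte_fin XY.
rewrite -EFinB -EFinM -EFinD -EFinM lee_fin.
apply: (@le_trans _ _ (2 * weight n.+1 1 m)%R); last by rewrite ler_wpM2l.
have -> : weight n.+1 1 m = ((1 + m) * weight n 1 m)%R.
  by rewrite /weight exprS mul1r ger0_norm.
have XYm : (Y t - X t <= 2 * (1 + m))%R.
  have : (`|Y t| <= m)%R by rewrite le_max lexx orbT.
  have : (`|X t| <= m)%R by rewrite le_max lexx.
  have := ler_norm (Y t); have := ler_norm (- X t)%R; rewrite normrN.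
  lra.
have := ler_wpM2l (weight_ge0 n m ler01) XYm.
lra.
Qed.

End gap_moments.

Section noise.
Context d (T : measurableType d) (R : realType) (P : probability T R).
Local Notation leb := (@lebesgue_measure R).
Local Open Scope ereal_scope.
Implicit Types X Y Z W : {RV P >-> R}.

(** Integrate [gap_cdf] against the translate of [h]. The four integrals are at most that of [h],
    hence finite, so the inequality between gaps transfers to the distribution functions. *)
Lemma le_integral_cdf_smoothing X Y (h : R -> \bar R) (t : R) :
  measurable_fun setT h -> (forall x, 0 <= h x) -> \int[leb]_x h x < +oo ->
  \int[leb]_y (gap X Y y * h (y + t)%R) <=
  \int[leb]_y (gap Y X y * h (y + t)%R) ->
  \int[leb]_y (cdf X y * h (y + t)%R) <= \int[leb]_y (cdf Y y * h (y + t)%R).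
Proof.
move=> mh h0 hoo le_gap.
have mht : measurable_fun setT (fun y : R => h (y + t)%R).
  apply: (measurableT_comp mh); exact: measurable_funD.
have mul_h (f : R -> \bar R) : measurable_fun setT f ->
    (forall y, 0 <= f y <= 1) ->
    measurable_fun setT (fun y : R => f y * h (y + t)%R) /\
    (forall y : R, 0 <= f y * h (y + t)%R) /\
    \int[leb]_y (f y * h (y + t)%R) \is a fin_num.
  move=> mf f01; have f0 y : 0 <= f y by have /andP[] := f01 y.
  have fh0 y : 0 <= f y * h (y + t)%R by rewrite mule_ge0.
  have mfh : measurable_fun setT (fun y : R => f y * h (y + t)%R).
    exact: emeasurable_funM.
  split => //; split => //.
  rewrite ge0_fin_numE; last exact: integral_ge0.
  apply: le_lt_trans hoo; rewrite -(ge0_integral_translation t mh h0).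
  apply: ge0_le_integral => //.
  move=> y _; rewrite -[leRHS]mul1e lee_wpmul2r//.
  by have /andP[] := f01 y.
have gap01 U V y : 0 <= gap (P := P) U V y <= 1.
  by rewrite gap_ge0 probability_le1//; exact: measurable_gap_set.
have cdf01 U y : 0 <= cdf (P := P) U y <= 1 by rewrite cdf_ge0 cdf_le1.
have [mgXY [gXY0 gXYfin]] := mul_h _ (measurable_gap X Y) (gap01 _ _).
have [mgYX [gYX0 gYXfin]] := mul_h _ (measurable_gap Y X) (gap01 _ _).
have [mcX [cX0 cXfin]] := mul_h _ (cdf_measurable X) (cdf01 _).
have [mcY [cY0 cYfin]] := mul_h _ (cdf_measurable Y) (cdf01 _).
have : \int[leb]_y (gap X Y y * h (y + t)%R) +
    \int[leb]_y (cdf Y y * h (y + t)%R) =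
    \int[leb]_y (gap Y X y * h (y + t)%R) +
    \int[leb]_y (cdf X y * h (y + t)%R).
  rewrite -!ge0_integralD//; apply: eq_integral => y _.
  by rewrite -!ge0_muleDl ?gap_ge0 ?cdf_ge0// gap_cdf.
move: le_gap gXYfin gYXfin cXfin cYfin.
move: (\int[leb]_y (gap X Y y * _)) (\int[leb]_y (gap Y X y * _)).
move: (\int[leb]_y (cdf X y * _)) (\int[leb]_y (cdf Y y * _)).
move=> [p| |]// [q| |]// [r| |]// [s| |]//.
rewrite !lee_fin => rs _ _ _ _ [].
lra.
Qed.

(* [eta] is the distribution of the opposite of the noise. *)
Lemma exists_noise_distribution X Y :
  (X : T -> R) \in Lfun P 1 -> (Y : T -> R) \in Lfun P 1 ->
  'E_P[Y] < 'E_P[X] ->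
  exists eta : probability (measurableTypeR R) R,
    (forall t : R, \int[eta]_v cdf X (t + v) <= \int[eta]_v cdf Y (t + v)) /\
    (all_moments_finite X -> all_moments_finite Y ->
     forall n, \int[eta]_v (`|v| ^+ n)%:E < +oo).
Proof.
move=> LX LY YX.
have gap_fin U V y : gap (P := P) U V y \is a fin_num.
  by apply: fin_num_measure; exact: measurable_gap_set.
have iXY : \int[leb]_y gap X Y y < \int[leb]_y gap Y X y.
  rewrite -sube_gt0 -expectation_gap// sube_gt0//.
have [h [mh h0 hgt0 hle hW]] := smoothing_density_exists
  (measurable_gap Y X) (measurable_gap X Y) (gap_ge0 Y X) (gap_ge0 X Y)
  (gap_fin _ _) (gap_fin _ _) (integral_gap_fin_num LY LX)
  (integral_gap_fin_num LX LY) iXY.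
have hoo : \int[leb]_x h x < +oo.
  have weight0 (f : R -> \bar R) :
      \int[leb]_x ((weight 0 1 x)%:E * f x) = \int[leb]_x f x.
    by apply: eq_integral => x _; rewrite /weight expr0 mul1e.
  (* Order 0 of the moment clause: the integral of the gap is finite, hence so is that of [h]. *)
  by rewrite -weight0; apply: hW; rewrite weight0 ltey_eq integral_gap_fin_num.
pose M := fine (\int[leb]_x h x).
have ME : \int[leb]_x h x = M%:E by rewrite fineK// ge0_fin_numE// ltW.
have M0 : (0 < M)%R by rewrite -lte_fin -ME.
pose k x := M^-1%:E * h x.
have M'0 : 0 <= M^-1%:E by rewrite lee_fin invr_ge0 ltW.
have mk : measurable_fun setT k by exact: emeasurable_funM.
have k0 x : 0 <= k x by rewrite mule_ge0.
have kE (f : R -> \bar R) : measurable_fun setT f -> (forall x, 0 <= f x) ->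
    \int[mdensity leb mk k0]_x f x = M^-1%:E * \int[leb]_x (f x * h x).
  move=> mf f0; rewrite ge0_integral_mdensity// /k.
  under eq_integral do rewrite muleCA.
  rewrite ge0_integralZl//; first exact: emeasurable_funM.
  by move=> x _; rewrite mule_ge0.
have k1 : mdensity leb mk k0 setT = 1.
  rewrite /mdensity /k ge0_integralZl// ME -EFinM mulVf// gt_eqF//.
pose eta : probability (measurableTypeR R) R := HB.pack (mdensity leb mk k0)
  (Measure_isProbability.Build _ _ _ (mdensity leb mk k0) k1).
exists eta; split.
  move=> t.
  (* The substitution y = t + v moves the translation onto [h], where the gap inequality applies at
     [- t]. *)
  have shift U : \int[eta]_v cdf (P := P) U (t + v) =
      M^-1%:E * \int[leb]_y (cdf U y * h (y - t)%R).
    have mc : measurable_fun setT (fun v : R => cdf U (t + v)).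
      apply: (measurableT_comp (cdf_measurable U)); exact: measurable_funD.
    rewrite kE//; congr (_ * _).
    rewrite -[RHS](ge0_integral_translation t).
    - by apply: eq_integral => v _; rewrite addrK addrC.
    - apply: emeasurable_funM; first exact: cdf_measurable.
      apply: (measurableT_comp mh); exact: measurable_funB.
    - by move=> y; rewrite mule_ge0 ?cdf_ge0.
  rewrite !shift lee_wpmul2l//.
  by apply: le_integral_cdf_smoothing => //; exact: hle.
move=> mX mY n; rewrite kE; last 2 first.
- apply/measurable_EFinP; apply: measurable_funX; exact: normr_measurable.
- by move=> x; rewrite lee_fin exprn_ge0.
rewrite lte_mul_pinfty//.
apply: le_lt_trans (hW n (integral_weight_gap_lty n mX mY)).
apply: ge0_le_integral => //.
- by move=> x _; rewrite mule_ge0// lee_fin exprn_ge0.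
- apply: emeasurable_funM => //; apply/measurable_EFinP.
  by apply: measurable_funX; exact: normr_measurable.
- apply: emeasurable_funM => //; apply/measurable_EFinP.
  exact: measurable_weight.
move=> x _; rewrite lee_wpmul2r// lee_fin /weight mul1r.
by rewrite lerXn2r ?nnegrE ?addr_ge0// lerDr.
Qed.

(** Tonelli over the product of the laws: for fixed Z = z, the event is X <= r - z. *)
Lemma cdf_add_independent X Z (r : R) : independent Z X ->
  cdf ((X \+ Z)%R : {RV P >-> R}) r = \int[P]_s cdf X (r - Z s).
Proof.
move=> ZX.
pose f (p : R * R) : \bar R := (\1_[set p : R * R | (p.2 + p.1 <= r)%R] p)%:E.
have mA : measurable [set p : R * R | (p.2 + p.1 <= r)%R].
  have m1 : measurable_fun setT (fun p : R * R => p.2 + p.1 <= r)%R.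
    by apply: measurable_fun_ler => //; exact: measurable_funD.
  by have := m1 measurableT [set true] I; rewrite setTI.
have mf : measurable_fun setT f.
  by apply/measurable_EFinP; exact: measurable_indic.
have f0 p : 0 <= f p by rewrite lee_fin.
transitivity (\int[P]_t f (Z t, X t)).
  rewrite /f -[RHS]/(\int[P]_t
    (\1_[set t | (X t + Z t <= r)%R] t)%:E).
  rewrite integral_indic//.
    rewrite setIT /cdf /distribution /pushforward; congr (P _).
  have m1 : measurable_fun setT (fun t => X t + Z t <= r)%R.
    by apply: measurable_fun_ler => //; exact: measurable_funD.
  by have := m1 measurableT [set true] I; rewrite setTI.
rewrite (ge0_integral_independent ZX mf f0).
transitivity (\int[distribution P Z]_z cdf X (r - z)).
  apply: eq_integral => z _; rewrite /f.
  transitivity (\int[distribution P X]_x (\1_(`]-oo, (r - z)%R]%classic) x)%:E).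
    apply: eq_integral => x _; rewrite !indicE; congr ((nat_of_bool _)%:R%:E).
    by apply/idP/idP; rewrite !inE/= in_itv/= lerBrDr.
  by rewrite integral_indic// setIT.
rewrite ge0_integral_distribution//.
by apply: (measurableT_comp (cdf_measurable X)); exact: measurable_funB.
Qed.

(* [W] may depend on [X] and [Y]: only the distribution of [Z'] matters, by
   independence of [Z'] from [X] and from [Y]. *)
Lemma le_cdf_add_noisier X Y Z Z' :
  (forall t : R, \int[P]_s cdf X (t - Z s) <= \int[P]_s cdf Y (t - Z s)) ->
  independent Z' X -> independent Z' Y -> noisier Z' Z ->
  forall r, cdf ((X \+ Z')%R : {RV P >-> R}) r <=
            cdf ((Y \+ Z')%R : {RV P >-> R}) r.
Proof.
move=> XYZ Z'X Z'Y [W WZ Z'E] r; rewrite !cdf_add_independent//.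
pose f U (p : R * R) := cdf (P := P) U (r - p.1 - p.2).
have mf U : measurable_fun setT (f U).
  apply: (measurableT_comp (cdf_measurable U)).
  by apply: measurable_funB => //; exact: measurable_funB.
have f0 U p : 0 <= f U p by exact: cdf_ge0.
(* For a fixed value w of [W], the inner integral is that of the noise [Z] alone at level [r - w],
   where the hypothesis applies. *)
have noiseE U : \int[P]_s cdf U (r - Z' s) =
    \int[distribution P W]_w \int[distribution P Z]_z f U (w, z).
  rewrite -(ge0_integral_independent WZ (mf U) (f0 U)).
  apply: eq_integral => s _; rewrite /f/= Z'E; congr (cdf U _).
  by rewrite opprD (addrC (- Z s)%R) addrA.
have mF U := measurable_fun_fubini_tonelli_F
  (m2 := distribution P Z) (f U) (mf U) (f0 U).
rewrite !noiseE; apply: ge0_le_integral => //.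
- by move=> w _; apply: integral_ge0 => z _; exact: cdf_ge0.
- exact: mF.
- exact: mF.
move=> w _; have mfw U : measurable_fun setT (fun z => f U (w, z)).
  rewrite /f/=; apply: (measurableT_comp (cdf_measurable U)).
  exact: measurable_funB.
have f0w U z : 0 <= f U (w, z) by exact: cdf_ge0.
rewrite (ge0_integral_distribution Z (mfw X) (f0w X)).
rewrite (ge0_integral_distribution Z (mfw Y) (f0w Y)).
exact: XYZ (r - w)%R.
Qed.

End noise.

(** * Transfer of laws to an enlarged space *)

Section same_law.
Context d d' (T : measurableType d) (T' : measurableType d') (R : realType)
  (P : probability T R) (Q : probability T' R).
Variables (X : {RV P >-> R}) (X' : {RV Q >-> R}).
Hypothesis XX' :
  forall A, measurable A -> distribution Q X' A = distribution P X A.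
Local Open Scope ereal_scope.

Lemma same_law_cdf r : cdf X' r = cdf X r.
Proof. exact: XX'. Qed.

Lemma same_law_integral (f : R -> \bar R) : measurable_fun setT f ->
  (forall x, 0 <= f x) -> \int[Q]_t f (X' t) = \int[P]_t f (X t).
Proof.
move=> mf f0; rewrite -[LHS](ge0_integral_distribution X' mf f0).
rewrite -[RHS](ge0_integral_distribution X mf f0).
by apply: eq_measure_integral => A mA _; exact: XX'.
Qed.

Lemma same_law_Lfun1 : (X : T -> R) \in Lfun P 1 -> (X' : T' -> R) \in Lfun Q 1.
Proof.
move=> /Lfun1_integrable/integrableP[_ iX]; apply/Lfun1_integrable/integrableP.
split; first exact/measurable_EFinP.
rewrite (same_law_integral (f := fun x => `|x%:E|))//.
by apply: measurableT_comp => //; exact/measurable_EFinP.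
Qed.

(** Positive and negative parts are transferred separately, as nonnegative functions of the
    variable. *)
Lemma same_law_expectation : 'E_Q[X'] = 'E_P[X].
Proof.
have integral_EFinE dU (U : measurableType dU) (m : probability U R)
    (V : {RV m >-> R}) : \int[m]_t (V t)%:E =
    \int[m]_t maxe (V t)%:E 0 - \int[m]_t maxe (- (V t)%:E) 0.
  rewrite integralE; congr (_ - _); apply: eq_integral => t _.
    by rewrite funeposE.
  by rewrite funenegE.
rewrite !unlock !integral_EFinE; congr (_ - _).
  apply: (same_law_integral (f := fun x => maxe x%:E 0)) => [|x].
    by apply: measurable_maxe => //; exact/measurable_EFinP.
  by rewrite le_max lexx orbT.
apply: (same_law_integral (f := fun x => maxe (- x%:E) 0)) => [|x].
  apply: measurable_maxe => //; under eq_fun do rewrite -EFinN.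
  by apply/measurable_EFinP; exact: measurable_funN.
by rewrite le_max lexx orbT.
Qed.

End same_law.

Section product_space.
Context d d' (T : measurableType d) (T' : measurableType d') (R : realType)
  (P : probability T R) (eta : probability T' R).
Local Open Scope ereal_scope.

Lemma distribution_fst (A : set T) : measurable A ->
  (P \x eta) (fst @^-1` A) = P A.
Proof.
move=> mA; rewrite -setXT product_measure1E//.
by rewrite -[RHS]mule1 -(probability_setT eta).
Qed.

Lemma distribution_snd (A : set T') : measurable A ->
  (P \x eta) (snd @^-1` A) = eta A.
Proof.
move=> mA; rewrite -setTX product_measure1E//.
by rewrite -[RHS]mul1e -(probability_setT P).
Qed.

End product_space.

(** * Construction of the noise on a product space and strict dominance *)

Theorem theorem1 (R : realType) (d : measure_display) (T : measurableType d)
    (P : probability T R) (X Y : {RV P >-> R}) :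
  (X : T -> R) \in Lfun P 1%E -> (Y : T -> R) \in Lfun P 1%E ->
  ('E_P[X] > 'E_P[Y])%E ->
  exists (d1 : measure_display) (T1 : measurableType d1)
         (P1 : probability T1 R) (pi1 : {RV P1 >-> T}) (Z : {RV P1 >-> R}),
    [/\ enlargement P pi1,
        independent Z (pairRV (X \o pi1) (Y \o pi1) : {RV P1 >-> (R * R)%type}),
        strictly_dominates1 ((X \o pi1) \+ Z : {RV P1 >-> R})
                            ((Y \o pi1) \+ Z : {RV P1 >-> R}),
        (forall (d2 : measure_display) (T2 : measurableType d2)
                (P2 : probability T2 R) (pi2 : {RV P2 >-> T1})
                (Z' : {RV P2 >-> R}),
            enlargement P1 pi2 ->
            independent Z' (X \o pi1 \o pi2 : {RV P2 >-> R}) ->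
            independent Z' (Y \o pi1 \o pi2 : {RV P2 >-> R}) ->
            noisier Z' (Z \o pi2 : {RV P2 >-> R}) ->
            strictly_dominates1 ((X \o pi1 \o pi2) \+ Z' : {RV P2 >-> R})
                                ((Y \o pi1 \o pi2) \+ Z' : {RV P2 >-> R}))
      & (all_moments_finite X -> all_moments_finite Y ->
         all_moments_finite Z)].
Proof.
move=> LX LY YX.
have [eta [eta_le eta_moments]] := exists_noise_distribution LX LY YX.
(* The second coordinate, of law [eta], is independent of the original space; [Z] is its
   opposite. *)
pose T1 : measurableType _ := (T * measurableTypeR R)%type.
pose P1 : probability T1 R := (P \x eta)%E.
have mZ : measurable_fun [set: T1] (fun p : T1 => - p.2 : R).
  exact: measurable_funN.
pose pi1 : {RV P1 >-> T} :=
  HB.pack (fst : T1 -> T) (isMeasurableFun.Build _ _ _ _ _ measurable_fst).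
pose Z : {RV P1 >-> R} :=
  HB.pack (fun p : T1 => - p.2 : R) (isMeasurableFun.Build _ _ _ _ _ mZ).
have eta_integralE (f : measurableTypeR R -> \bar R) :
    measurable_fun setT f -> (forall v, (0 <= f v)%E) ->
    (\int[P1]_p f p.2 = \int[eta]_v f v)%E.
  move=> mf f0.
  rewrite (eq_measure_integral (pushforward P1 snd)); last first.
    by move=> A mA _; exact/esym/distribution_snd.
  by rewrite ge0_integral_pushforward//; exact: measurable_snd.
(* Stated for any measurable function of the first coordinate, so as to cover [X], [Y] and the
   pair. *)
have indZ dU (U : measurableType dU) (V : T -> U) : measurable_fun setT V ->
    forall A B, measurable A -> measurable B ->
    P1 (Z @^-1` A `&` (V \o pi1) @^-1` B) =
    (P1 (Z @^-1` A) * P1 ((V \o pi1) @^-1` B))%E.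
  move=> mV A B mA mB.
  have mVB : measurable (V @^-1` B).
    by rewrite -[X in measurable X]setTI; exact: mV.
  pose NA : set (measurableTypeR R) := [set v | A (- v)].
  have mNA : measurable NA.
    have mN : measurable_fun [set: measurableTypeR R]
      (fun v : measurableTypeR R => - v : R) by exact: measurable_funN.
    by rewrite -[X in measurable X]setTI; exact: mN.
  rewrite -[P1 (Z @^-1` A)]/((P \x eta)%E (snd @^-1` NA)) distribution_snd//.
  rewrite -[P1 (_ @^-1` B)]/((P \x eta)%E (fst @^-1` (V @^-1` B))).
  rewrite distribution_fst//.
  rewrite muleC -(product_measure1E P eta mVB mNA); congr ((P \x eta)%E _).
  by apply/seteqP; split => p /= [].
have law2 d2 (T2 : measurableType d2) (P2 : probability T2 R)
    (pi2 : {RV P2 >-> T1}) (U : {RV P >-> R}) : enlargement P1 pi2 ->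
    forall A, measurable A ->
    distribution P2 (U \o pi1 \o pi2 : {RV P2 >-> R}) A = distribution P U A.
  move=> en A mA.
  have mUA : measurable (U @^-1` A) by exact: measurable_funPTI.
  transitivity (P1 (fst @^-1` (U @^-1` A))); last exact: distribution_fst.
  apply: en; exact: (measurable_funPTI pi1).
have main d2 (T2 : measurableType d2) (P2 : probability T2 R)
    (pi2 : {RV P2 >-> T1}) (Z' : {RV P2 >-> R}) :
    enlargement P1 pi2 ->
    independent Z' (X \o pi1 \o pi2 : {RV P2 >-> R}) ->
    independent Z' (Y \o pi1 \o pi2 : {RV P2 >-> R}) ->
    noisier Z' (Z \o pi2 : {RV P2 >-> R}) ->
    strictly_dominates1 ((X \o pi1 \o pi2) \+ Z' : {RV P2 >-> R})
                        ((Y \o pi1 \o pi2) \+ Z' : {RV P2 >-> R}).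
  move=> en Z'X Z'Y Z'Z.
  have lawX := law2 _ _ _ _ X en; have lawY := law2 _ _ _ _ Y en.
  split.
    apply: le_cdf_dominates1; apply: (le_cdf_add_noisier _ Z'X Z'Y Z'Z) => t.
    have noiseE (U : {RV P >-> R}) :
        (\int[P2]_s cdf (U \o pi1 \o pi2 : {RV P2 >-> R}) (t - (Z \o pi2) s) =
         \int[eta]_v cdf U (t + v))%E.
      pose f (v : measurableTypeR R) := cdf U (t + v).
      have mf : measurable_fun setT f.
        apply: (measurableT_comp (cdf_measurable U)); exact: measurable_funD.
      have f0 v : (0 <= f v)%E by exact: cdf_ge0.
      (* The two minus signs cancel, and the law of [pi2] is [P1], whose second marginal is
         [eta]. *)
      transitivity (\int[P2]_s (f \o snd) (pi2 s))%E.
        apply: eq_integral => s _; rewrite (same_law_cdf (law2 _ _ _ _ U en)).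
        by rewrite /f/= opprK.
      have mfs : measurable_fun [set: T1] (f \o snd) by exact: measurableT_comp.
      rewrite -[LHS](ge0_integral_distribution pi2 mfs)//.
      rewrite (eq_measure_integral P1); last by move=> A mA _; exact: en.
      exact: eta_integralE.
    by rewrite !noiseE.
  have LX' := same_law_Lfun1 lawX LX; have LY' := same_law_Lfun1 lawY LY.
  (* Equal distributions would force equal expectations, against the strict inequality. *)
  move=> /(add_same_distribution LX' LY').
  rewrite (same_law_expectation lawX) (same_law_expectation lawY) => XY.
  by move: YX; rewrite XY ltxx.
exists _, T1, P1, pi1, Z; split => //.
- by move=> A mA; exact: distribution_fst.
- move=> A B mA mB; exact: (indZ _ _ (pairRV X Y)).
(* Dominance for [Z] itself is the case of the identity enlargement with W = 0, a constant being
   independent of every variable. *)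
- pose id1 : {RV P1 >-> T1} :=
    HB.pack (id : T1 -> T1)
      (isMeasurableFun.Build _ _ _ _ _ (@measurable_id _ T1 setT)).
  apply: (main _ T1 P1 id1 Z).
  + by [].
  + by move=> A B mA mB; exact: (indZ _ _ X).
  + by move=> A B mA mB; exact: (indZ _ _ Y).
  + exists (cst 0 : {RV P1 >-> R}) => [A B mA mB|p]; last by rewrite addr0.
    rewrite /distribution /pushforward preimage_cst.
    case: ifP => _; first by rewrite setTI probability_setT mul1e.
    by rewrite set0I !measure0 mul0e.
- move=> mX mY n; rewrite unlock.
  pose f (v : measurableTypeR R) := (`|v| ^+ n)%:E.
  have mf : measurable_fun setT f.
    by apply/measurable_EFinP; apply: measurable_funX; exact: normr_measurable.
  have f0 v : (0 <= f v)%E by rewrite lee_fin exprn_ge0.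
  apply: le_lt_trans (eta_moments mX mY n); rewrite -(eta_integralE _ mf f0).
  by rewrite (eq_integral (fun p => f p.2))// => p _; rewrite /f/= normrN.
Qed.
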